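(* Let $0<\alpha\le1$, $\theta>0$, and let $M_{\alpha,\theta}(t)=M(G_{\alpha,\theta}(t))$, $t\ge0$, where $\{M(t)\}_{t\ge0}$ is a generalized counting process with positive rates $\lambda_1,\dots,\lambda_k$, independent of the tempered subordinator $\{G_{\alpha,\theta}(t)\}_{t\ge0}$ with Laplace exponent $\phi_{\alpha,\theta}(\eta)=\alpha\gamma(\alpha;\eta+\theta)-\alpha\gamma(\alpha;\theta)$. The process $\{M_{\alpha,\theta}(t)\}_{t\ge0}$ has the long-range dependence (LRD) property.
   Context: Generalized counting process (GCP): for $k\ge1$ and $\lambda_1,\dots,\lambda_k>0$, it is the non-negative integer valued Lévy process $\{M(t)\}_{t\ge0}$, $M(0)=0$, with $\Pr\{M(t+h)=n+j\mid M(t)=n\}=1-\Lambda h+o(h)$ for $j=0$, $=\lambda_jh+o(h)$ for $1\le j\le k$, $=o(h)$ for $j\ge k+1$, where $\Lambda=\sum_{j=1}^k\lambda_j$. Equivalently $\mathbb{E}(u^{M(t)})=\exp(-t\sum_{j=1}^k\lambda_j(1-u^j))$ for $|u|\le1$. $\gamma(\alpha;\eta)=\int_0^\eta e^{-x}x^{\alpha-1}\,\mathrm{d}x$ is the lower incomplete gamma function. $\{G_{\alpha,\theta}(t)\}$ is the non-decreasing Lévy process with $\mathbb{E}(e^{-\eta G_{\alpha,\theta}(t)})=\exp(-t\phi_{\alpha,\theta}(\eta))$, $\eta>0$. LRD property: a process $\{X(t)\}_{t\ge0}$ with finite positive variances for $t>0$ has the LRD property if for each fixed $s>0$ there is a constant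 $c(s)>0$ such that $\operatorname{Corr}(X(s),X(t))\sim c(s)\,t^{-d}$ as $t\to\infty$, for some $d\in(0,1)$ not depending on $s$. *)

(* Defs.v *)
From HB Require Import structures.
From mathcomp Require Import all_boot all_order all_algebra.
From mathcomp Require Import all_classical all_reals all_analysis.
Import Order.TTheory GRing.Theory Num.Theory.
Import numFieldNormedType.Exports.

Set Implicit Arguments.
Unset Strict Implicit.
Unset Printing Implicit Defensive.

Local Open Scope classical_set_scope.
Local Open Scope ring_scope.

Section processes.
Context {R : realType} {d : measure_display} {T : measurableType d}.
Variable P : probability T R.

(* Processes {X(t)}_{t >= 0} are functions X : R -> T -> R whose values at
   negative times are ignored by every definition below. *)
Definition stochastic_process (X : R -> T -> R) : Prop :=
  forall t, 0 <= t -> measurable_fun setT (X t).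

Definition independent_RVs (n : nat) (X : 'I_n -> T -> R) : Prop :=
  forall B : 'I_n -> set R, (forall i, measurable (B i)) ->
    P (\bigcap_i (X i @^-1` B i)) = (\prod_(i < n) P (X i @^-1` B i))%E.

Definition independent_increments (X : R -> T -> R) : Prop :=
  forall (n : nat) (t : nat -> R),
    0 <= t 0%N -> {homo t : i j / (i <= j)%N >-> i <= j} ->
    independent_RVs (fun (i : 'I_n) w => X (t i.+1) w - X (t i) w).

Definition stationary_increments (X : R -> T -> R) : Prop :=
  forall s t (B : set R), 0 <= s -> 0 <= t -> measurable B ->
    P [set w | B (X (s + t) w - X s w)] = P [set w | B (X t w - X 0 w)].

Definition stochastically_continuous (X : R -> T -> R) : Prop :=
  forall s e, 0 <= s -> 0 < e ->
    P [set w | e < `|X t w - X s w| ] @[t --> within `[0, +oo[ (nbhs s)]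
      --> 0%E.

Definition cadlag (x : R -> R) : Prop :=
  (forall t, 0 <= t -> x u @[u --> t^'+] --> x t) /\
  (forall t, 0 < t -> cvg (x u @[u --> t^'-])).

(* All sample paths (rather than almost all) start at 0 and are cadlag, so that
   the composition of two such processes is again a process. *)
Record levy_process (X : R -> T -> R) : Prop := LevyProcess {
  levy_measurable : stochastic_process X;
  levy_start : forall w, X 0 w = 0;
  levy_independent_increments : independent_increments X;
  levy_stationary_increments : stationary_increments X;
  levy_stochastically_continuous : stochastically_continuous X;
  levy_cadlag : forall w, cadlag (X ^~ w)
}.

(* The sigma-algebra generated by all the X(t), t >= 0. *)
Definition sigma_process (X : R -> T -> R) : set (set T) :=
  <<s [set A | exists t, exists B : set R,
         [/\ 0 <= t, measurable B & A = X t @^-1` B]] >>.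

Definition independent_processes (X Y : R -> T -> R) : Prop :=
  forall A B, sigma_process X A -> sigma_process Y B ->
    P (A `&` B) = (P A * P B)%E.

(* Pr(A | B), meaningful only when P B is nonzero. *)
Definition cond_prob (A B : set T) : R := fine (P (A `&` B)) / fine (P B).

(* Lambda = lambda_1 + ... + lambda_k *)
Definition total_rate (k : nat) (lambda : nat -> R) : R :=
  \sum_(1 <= j < k.+1) lambda j.

(* The infinitesimal transition probabilities are required at those (t, n) for
   which the conditioning event M(t) = n has positive probability. *)
Record generalized_counting_process (k : nat) (lambda : nat -> R)
    (M : R -> T -> R) : Prop := GeneralizedCountingProcess {
  gcp_levy : levy_process M;
  gcp_nat : forall t w, 0 <= t -> exists n : nat, M t w = n%:R;
  gcp_transition : forall (t : R) (n j : nat), 0 <= t ->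
    P [set w | M t w = n%:R] != 0%E ->
    let p := fun h : R => cond_prob [set w | M (t + h) w = (n + j)%:R]
                                    [set w | M t w = n%:R] in
    [/\ (j = 0)%N -> (fun h : R => p h - (1 - total_rate k lambda * h))
                       =o_ (0^'+) (fun h : R => h),
        (1 <= j <= k)%N -> (fun h : R => p h - lambda j * h)
                             =o_ (0^'+) (fun h : R => h) &
        (k.+1 <= j)%N -> p =o_ (0^'+) (fun h : R => h)]
}.

(* gamma(alpha; eta), the lower incomplete gamma function *)
Definition lower_gamma (alpha eta : R) : R :=
  \int[lebesgue_measure]_(x in `]0, eta]) (expR (- x) * x `^ (alpha - 1)).

Definition phi (alpha theta eta : R) : R :=
  alpha * lower_gamma alpha (eta + theta) - alpha * lower_gamma alpha theta.

Record tempered_subordinator (alpha theta : R) (G : R -> T -> R) : Prop :=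
    TemperedSubordinator {
  tsub_levy : levy_process G;
  tsub_nondecreasing : forall w s t, 0 <= s -> s <= t -> G s w <= G t w;
  tsub_laplace : forall t eta, 0 <= t -> 0 < eta ->
    'E_P[(fun w => expR (- (eta * G t w)))]%E
      = (expR (- (t * phi alpha theta eta)))%:E
}.

Definition subordinated (M G : R -> T -> R) : R -> T -> R :=
  fun t w => M (G t w) w.

Definition correlation (X Y : T -> R) : R :=
  fine (covariance P X Y) /
  (Num.sqrt (fine ('V_P[X])%E) * Num.sqrt (fine ('V_P[Y])%E)).

(* Corr(X(s), X(t)) ~ c(s) t^(-delta) is stated as: the ratio tends to 1. *)
Definition LRD (X : R -> T -> R) : Prop :=
  [/\ stochastic_process X,
      forall t, 0 < t -> X t \in Lfun P 2%:E /\ (0 < 'V_P[X t])%E &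
      exists2 delta : R, 0 < delta < 1 &
        forall s, 0 < s -> exists2 c : R, 0 < c &
          correlation (X s) (X t) / (c * t `^ (- delta)) @[t --> +oo] --> (1 : R)].

End processes.

(* Main.v *)
(* The proof gives the exponent 1/2: for 0 <= s <= t the increment
   X(t) - X(s) of X = M o G has mean (t - s) m and variance (t - s) v with
   v > 0, so that Cov(X(s), X(t)) = s v by polarisation and
   Corr(X(s), X(t)) = sqrt(s / t).
   The two moments are read off the Laplace transform of |X(t) - X(s)|, which
   is exp(-(t - s) phi(psi(eta))), psi(eta) = sum_j lambda_j (1 - e^(-j eta)).
   For M this transform follows from the semigroup property and the
   infinitesimal transition probabilities; it is carried through the time change
   by approximating G from the right with processes on a grid, where
   conditioning on G is a countable sum.  The absolute value makes monotonicity
   of the paths of M unnecessary; v > 0 comes from phi' > 0, phi'' <= 0 and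
   psi'' < 0 at 0, where alpha <= 1 is used. *)

Require Import Defs.
From HB Require Import structures.
From mathcomp Require Import all_boot all_order all_algebra.
From mathcomp Require Import all_classical all_reals all_analysis.
From mathcomp Require Import measurable_realfun.
From mathcomp Require Import ring lra.
Import Order.TTheory GRing.Theory Num.Theory.
Import numFieldNormedType.Exports.
Set Implicit Arguments.
Unset Strict Implicit.
Unset Printing Implicit Defensive.
Local Open Scope classical_set_scope.
Local Open Scope ring_scope.

(** * Integration on a probability space *)

(** Coding the values by [pickle] turns the fibres into a sequence of sets, the form in which
    countable additivity applies. Codes that are not attained give empty fibres. *)
Lemma countable_fibers_bigcup {T : Type} {I : countType} (kappa : T -> I) :
  \bigcup_n [set w | pickle (kappa w) = n] = setT.
Proof. by apply/seteqP; split=> // w _; exists (pickle (kappa w)). Qed.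

Lemma countable_fiberE {T : Type} {I : countType} (kappa : T -> I) (w : T) :
  [set w' | pickle (kappa w') = pickle (kappa w)] =
  kappa @^-1` [set kappa w].
Proof.
by apply/seteqP; split=> w' /=; [exact: (pcan_inj pickleK)|move=> ->].
Qed.

Lemma measurable_countable_fiber {d : measure_display} {T : measurableType d}
    {I : countType} (kappa : T -> I) (n : nat) :
  (forall i, measurable (kappa @^-1` [set i])) ->
  measurable [set w | pickle (kappa w) = n].
Proof.
move=> mk; have [->|/set0P[w /= <-]] :=
  eqVneq [set w | pickle (kappa w) = n] set0; first exact: measurable0.
by rewrite countable_fiberE.
Qed.

Lemma measurable_fun_countable {d d' : measure_display} {T : measurableType d}
    {T' : measurableType d'} {I : countType} (kappa : T -> I)
    (Z : I -> T -> T') :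
  (forall i, measurable (kappa @^-1` [set i])) ->
  (forall i, measurable_fun setT (Z i)) ->
  measurable_fun setT (fun w => Z (kappa w) w).
Proof.
move=> mk mZ; rewrite -(countable_fibers_bigcup kappa).
apply/measurable_fun_bigcup => n; first exact: measurable_countable_fiber.
have [->|/set0P[w /= <-]] := eqVneq [set w | pickle (kappa w) = n] set0.
  exact: measurable_fun_set0.
rewrite countable_fiberE; apply: (eq_measurable_fun (Z (kappa w))).
  by move=> w'; rewrite inE /= => ->.
exact: measurable_funTS.
Qed.

(** * Conditioning on an independent, countably valued variable *)

Section independence.
Context {R : realType} {d : measure_display} {T : measurableType d}.
Variable P : probability T R.

(** The restriction of [P] to [A] and the multiple [P A * P] have the same image under [Z]: this is
    exactly the product formula. Integrals of [Z] depend on the image measure only. *)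
Lemma ge0_integral_indep_set (A : set T) (Z : T -> R) :
  measurable A -> measurable_fun setT Z -> (forall w, 0 <= Z w) ->
  (forall B, measurable B -> P (A `&` Z @^-1` B) = (P A * P (Z @^-1` B))%E) ->
  (\int[P]_(w in A) (Z w)%:E = P A * \int[P]_w (Z w)%:E)%E.
Proof.
move=> mA mZ Z0 AZ.
(* The integrand on the line must be non-negative everywhere. The absolute value is, and it agrees
   with the identity on the values of [Z]. *)
pose absE (y : R) : \bar R := `|y|%:E.
have mabs : measurable_fun setT absE.
  by apply/measurable_EFinP; exact: normr_measurable.
have mZE D : measurable_fun D (fun w => (Z w)%:E).
  by apply: measurable_funTS; exact/measurable_EFinP.
have push (m : {measure set T -> \bar R}) :
    (\int[m]_w (Z w)%:E = \int[pushforward m Z]_y absE y)%E.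
  rewrite (ge0_integral_pushforward mZ) ?preimage_setT//.
    by apply: eq_integral => w _; rewrite /absE/= ger0_norm.
  by move=> y _; rewrite lee_fin.
pose nu := mrestr P mA.
transitivity (\int[nu]_w (Z w)%:E)%E.
  rewrite (@ge0_negligible_integral _ _ _ nu setT (~` A))//; first last.
  - by change (P (~` A `&` A) = 0%E); rewrite setICl measure0.
  - by move=> w _; rewrite lee_fin.
  - exact: measurableC.
  rewrite setTD setCK; apply: eq_measure_integral => B mB BA.
  by change (P B = P (B `&` A)); rewrite setIidl.
have PA0 : 0 <= fine (P A) by exact: fine_ge0.
have PAE : ((fine (P A))%:E = P A)%E by rewrite fineK// fin_num_measure.
transitivity (\int[mscale (NngNum PA0) P]_w (Z w)%:E)%E; last first.
  rewrite ge0_integral_mscale//=; first by rewrite PAE.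
  by move=> w _; rewrite lee_fin.
rewrite !push; apply: eq_measure_integral => B mB _.
by change (P (Z @^-1` B `&` A) = ((fine (P A))%:E * P (Z @^-1` B))%E);
  rewrite PAE setIC AZ.
Qed.

(* Conditioning on a countably valued [kappa]: the form of Fubini's theorem that
   serves both the semigroup property of a Levy process and subordination. *)
Lemma ge0_integral_countable_indep (I : countType) (kappa : T -> I)
    (Z : I -> T -> R) (c : I -> R) :
  (forall i, measurable (kappa @^-1` [set i])) ->
  (forall i, measurable_fun setT (Z i)) -> (forall i w, 0 <= Z i w) ->
  (forall i B, measurable B -> P (kappa @^-1` [set i] `&` Z i @^-1` B) =
     (P (kappa @^-1` [set i]) * P (Z i @^-1` B))%E) ->
  (forall w, \int[P]_w' (Z (kappa w) w')%:E = (c (kappa w))%:E)%E ->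
  (\int[P]_w (Z (kappa w) w)%:E = \int[P]_w (c (kappa w))%:E)%E.
Proof.
move=> mk mZ Z0 kZ cE.
pose A n := [set w | pickle (kappa w) = n].
have AT : \bigcup_n A n = setT by exact: countable_fibers_bigcup.
have mA n : measurable (A n) by exact: measurable_countable_fiber.
have trivA : trivIset setT A by move=> i j _ _ [w [<- <-]].
have c0 w : 0 <= c (kappa w).
  by rewrite -lee_fin -cE; apply: integral_ge0 => w' _; rewrite lee_fin.
have mc : measurable_fun setT (fun w => (c (kappa w))%:E).
  apply/measurable_EFinP.
  by apply: (measurable_fun_countable (Z := fun i _ => c i)) => i.
have mZk : measurable_fun setT (fun w => (Z (kappa w) w)%:E).
  by apply/measurable_EFinP; exact: measurable_fun_countable.
rewrite -AT !ge0_integral_bigcup//; last 4 first.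
- by rewrite AT.
- by move=> w _; rewrite lee_fin.
- by rewrite AT.
- by move=> w _; rewrite lee_fin.
apply: eq_eseriesr => n _.
(* A non-empty fibre has the code of some [kappa w]. Hence [cE] is only invoked at attained
   values. *)
have [->|/set0P[w /= <-]] := eqVneq (A n) set0; first by rewrite !integral_set0.
rewrite /A countable_fiberE.
transitivity (\int[P]_(w0 in kappa @^-1` [set kappa w]) (Z (kappa w) w0)%:E)%E.
  by apply: eq_integral => w'; rewrite inE/= => ->.
transitivity (\int[P]_(w0 in kappa @^-1` [set kappa w]) (c (kappa w))%:E)%E;
    last first.
  by apply: eq_integral => w'; rewrite inE/= => ->.
rewrite ge0_integral_indep_set//; last by move=> B mB; exact: kZ.
by rewrite cE integral_cst// muleC.
Qed.

End independence.

(** * Bounded integrands and square integrability *)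

Lemma probability_integrable_bounded {R : realType} {d : measure_display}
    {T : measurableType d} (P : probability T R) (f : T -> R) (C : R) :
  measurable_fun setT f -> (forall w, 0 <= f w <= C) ->
  P.-integrable setT (EFin \o f).
Proof.
move=> mf fC; apply: measurable_bounded_integrable => //.
  exact: le_lt_trans (probability_le1 P measurableT) (ltry _).
exists C; split; first exact: num_real.
move=> M M1 w _ /=; have /andP[f0 fc] := fC w.
by rewrite ger0_norm// (le_trans fc)// ltW.
Qed.

Lemma Rintegral_sum {R : realType} {d : measure_display} {T : measurableType d}
    (mu : {measure set T -> \bar R}) (D : set T) (I : Type) (s : seq I)
    (f : I -> T -> R) : measurable D ->
  (forall i, mu.-integrable D (EFin \o f i)) ->
  \int[mu]_(x in D) (\sum_(i <- s) f i x) =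
  \sum_(i <- s) \int[mu]_(x in D) f i x.
Proof.
move=> mD intf; rewrite /Rintegral.
under eq_integral do rewrite -sumEFin.
rewrite integral_sum// sum_fine// => i _.
by apply: integrable_fin_num => //; exact: intf.
Qed.

Lemma measurable_expRNM {R : realType} {d : measure_display}
    {T : measurableType d} (eta : R) (f : T -> R) : measurable_fun setT f ->
  measurable_fun setT (fun w => expR (- (eta * f w))).
Proof.
move=> mf; apply: measurableT_comp => //; apply: measurableT_comp => //.
exact: measurable_funM.
Qed.

Lemma expRNM01 {R : realType} (eta x : R) : 0 <= eta -> 0 <= x ->
  0 <= expR (- (eta * x)) <= 1.
Proof. by move=> e0 x0; rewrite expR_ge0 -expR0 ler_expR oppr_le0 mulr_ge0. Qed.

Lemma cvg_integral_bounded {R : realType} {d : measure_display}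
    {T : measurableType d} (P : probability T R) (f_ : nat -> T -> R)
    (f : T -> R) (C : R) :
  (forall n, measurable_fun setT (f_ n)) -> measurable_fun setT f ->
  (forall n w, `|f_ n w| <= C) ->
  (forall w, f_ n w @[n --> \oo] --> f w) ->
  (\int[P]_w (f_ n w)%:E @[n --> \oo] --> \int[P]_w (f w)%:E)%E.
Proof.
move=> mf_ mf fC f_f.
have [] := @dominated_convergence _ _ _ P setT measurableT
  (fun n w => (f_ n w)%:E) (fun w => (f w)%:E) (fun=> C%:E) _ _ _ _ _ => //.
- by move=> n; exact/measurable_EFinP.
- exact/measurable_EFinP.
- by apply/aeW => w _; apply/cvg_EFin; [exact: nearW|exact: f_f].
- exact: finite_measure_integrable_cst.
- by apply/aeW => w n _; rewrite lee_fin.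
Qed.

Lemma Lfun2_integral_sqr {R : realType} {d : measure_display}
    {T : measurableType d} (mu : {measure set T -> \bar R}) (f : T -> R) :
  measurable_fun setT f -> (\int[mu]_x (f x ^+ 2)%:E < +oo)%E ->
  f \in Lfun mu 2%:E.
Proof.
move=> mf f2; rewrite inE; apply/andP; split; rewrite inE//=.
rewrite /finite_norm unlock /Lnorm; apply: poweR_lty.
apply: le_lt_trans f2; rewrite le_eqVlt; apply/orP; left; apply/eqP.
by apply: eq_integral => x _; rewrite /= powR_mulrn// real_normK ?num_real.
Qed.

(** * Derivatives at 0 from the right *)

Lemma is_derive_cvg_at_right {R : realType} (f : R -> R) (x l : R) :
  is_derive x 1 f l -> (f (x + h) - f x) / h @[h --> 0^'+] --> l.
Proof.
move=> [df <-]; apply: cvg_dnbhs_at_right.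
rewrite (_ : (fun h => _) =
  (fun h => h^-1 *: ((f \o shift x) (h *: (1 : R)) - f x))); first exact: df.
by apply/funext => h /=; rewrite /GRing.scale/= mulr1 mulrC [h + x]addrC.
Qed.

(** One application of L'Hopital's rule leaves [(dF (2 * x) - dF x) / x], a difference quotient at 0
    whose limit is [2 * d2 - d2]. Thus [dF] has to be differentiable at 0 only. *)
Lemma cvg_second_difference {R : realType} (F dF : R -> R) (d2 : R) :
  (forall x : R, 0 <= x -> is_derive x 1 F (dF x)) ->
  is_derive (0 : R) 1 dF d2 ->
  (F 0 - 2 * F x + F (2 * x)) / x ^+ 2 @[x --> 0^'+] --> d2.
Proof.
move=> FdF dFd2.
have scale (x : R) (f : R -> R) (df : R) : is_derive (2 * x) 1 f df ->
    is_derive x 1 (fun y : R => f (2 * y)) (2 * df).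
  move=> fdf; have s2 : is_derive x 1 (fun y : R => 2 * y) 2.
    by apply: is_derive_eq; rewrite [_ *: _]mulr1.
  by have := is_derive1_comp (g := fun y => 2 * y) fdf s2; rewrite mulrC.
have dF2 (x : R) : 0 <= x ->
    is_derive x 1 (fun x => F 0 - 2 * F x + F (2 * x))
      (2 * (dF (2 * x) - dF x)).
  move=> x0; have d1 := FdF _ x0.
  have x20 : 0 <= 2 * x by rewrite mulr_ge0.
  have d3 := scale _ _ _ (FdF _ x20).
  by apply: is_derive_eq; cbn; ring.
apply: (@lhopital_at_right R (fun x => F 0 - 2 * F x + F (2 * x))
  (fun x => 2 * (dF (2 * x) - dF x)) (fun x => x ^+ 2)
  (fun x => 2 * x) 0 1) => //.
- by move=> x; rewrite in_itv/= => /andP[x0 _]; apply: dF2; exact: ltW.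
- move=> x _; apply: is_derive_eq; cbn; ring.
- have : {for (0 : R), continuous (fun x => F 0 - 2 * F x + F (2 * x))}.
    apply: differentiable_continuous; apply/derivable1_diffP.
    by have [] := dF2 _ (lexx 0).
  rewrite /prop_for /continuous_at mulr0.
  rewrite (_ : F 0 - 2 * F 0 + F 0 = 0); last by ring.
  by move=> H; exact: cvg_at_right_filter.
- apply: cvg_at_right_filter.
  rewrite -[X in _ --> X](expr0n R 2).
  exact: exprn_continuous.
- by move=> x; rewrite in_itv/= => /andP[x0 _]; rewrite mulf_neq0// gt_eqF.
have dK : is_derive (0 : R) 1 (fun x => dF (2 * x) - dF x) d2.
  have d3 : is_derive (0 : R) 1 (fun x => dF (2 * x)) (2 * d2).
    by apply: scale; rewrite mulr0.
  by apply: is_derive_eq; ring.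
have := is_derive_cvg_at_right dK.
rewrite mulr0 subrr.
apply: cvg_trans; apply: near_eq_cvg; near=> x.
have x0 : x != 0 by rewrite gt_eqF//; near: x; exact: nbhs_right_gt.
by rewrite add0r subr0; field.
Unshelve. all: by end_near. Qed.

Lemma is_derive_bigsum {R : realType} (I : Type) (s : seq I) (f : I -> R -> R)
    (df : I -> R) (x : R) : (forall i, is_derive x 1 (f i) (df i)) ->
  is_derive x 1 (fun y => \sum_(i <- s) f i y) (\sum_(i <- s) df i).
Proof.
move=> fdf; elim: s => [|i s IH].
  rewrite big_nil (_ : (fun y => _) = fun=> 0); last first.
    by apply/funext => y; rewrite big_nil.
  exact: is_derive_cst.
rewrite big_cons (_ : (fun y => _) =
    (f i + (fun y => \sum_(j <- s) f j y))); last first.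
  by apply/funext => y; rewrite big_cons.
exact: is_deriveD.
Qed.

(** * Moments from the Laplace transform *)

Section laplace_moments.
Context {R : realType} {d : measure_display} {T : measurableType d}.
Variables (P : probability T R) (Y : T -> R) (L : R -> R).
Hypotheses (mY : measurable_fun setT Y) (Y0 : forall w, 0 <= Y w).
Hypothesis LE : forall eta, 0 < eta ->
  (\int[P]_w (expR (- (eta * Y w)))%:E = (L eta)%:E)%E.

(* Along [eta = 2^-n] the quotients [(1 - e^(-eta y)) / eta] increase to [y], so
   that monotone convergence needs no prior integrability of [Y]. *)
Let q (n : nat) (y : R) : R := (1 - expR (- (2^-1 ^+ n * y))) / 2^-1 ^+ n.

Let eta_gt0 n : 0 < 2^-1 ^+ n :> R. Proof. by rewrite exprn_gt0. Qed.

Let eta_cvg0 : (2^-1 : R) ^+ n @[n --> \oo] --> (0 : R).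
Proof. by apply: cvg_expr; rewrite ger0_norm// invf_lt1// ltr1n. Qed.

Let q_ge0 n y : 0 <= y -> 0 <= q n y.
Proof.
move=> y0; rewrite /q divr_ge0 ?(ltW (eta_gt0 n))// subr_ge0 -expR0.
rewrite ler_expR oppr_le0.
by rewrite mulr_ge0// ltW.
Qed.

Let q_nd y : 0 <= y -> nondecreasing_seq (q ^~ y).
Proof.
move=> y0; apply/nondecreasing_seqP => n; rewrite /q exprSr.
set e := 2^-1 ^+ n; have e0 : 0 < e by exact: eta_gt0.
set a := expR (- (e * 2^-1 * y)).
(* With [a = e^(- e y / 2)], halving the step changes the numerator over [e] from [1 - a^2] to
   [2 - 2 a]; the gain is [(1 - a)^2]. *)
have -> : expR (- (e * y)) = a * a.
  by rewrite /a -expRD; congr expR; field.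
have -> : (1 - a) / (e * 2^-1) = (2 - 2 * a) / e by field; rewrite gt_eqF.
rewrite ler_pM2r ?invr_gt0// -subr_ge0.
have -> : 2 - 2 * a - (1 - a * a) = (1 - a) ^+ 2 by ring.
exact: sqr_ge0.
Qed.

Let q_cvg y : q n y @[n --> \oo] --> y.
Proof.
have dy : is_derive (0 : R) 1 (fun x => 1 - expR (- (x * y))) y.
  apply: is_derive_eq.
  by rewrite mul0r oppr0 expR0; cbn; ring.
have /cvg_at_rightP := is_derive_cvg_at_right dy.
move=> /(_ (fun n => 2^-1 ^+ n)) /=.
rewrite mul0r oppr0 expR0 subrr.
rewrite (_ : (fun n => q n y) = (fun n =>
  (1 - expR (- ((0 + 2^-1 ^+ n) * y)) - 0) / 2^-1 ^+ n)); last first.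
  by apply/funext => n; rewrite add0r subr0.
by apply; split.
Qed.

Let integ eta : 0 < eta ->
  P.-integrable setT (EFin \o (fun w => expR (- (eta * Y w)))).
Proof.
move=> eta0; apply: (@probability_integrable_bounded _ _ _ P _ 1).
  exact: measurable_expRNM.
by move=> w; apply: expRNM01 => //; exact: ltW.
Qed.

Let RintE eta : 0 < eta -> \int[P]_w expR (- (eta * Y w)) = L eta.
Proof. by move=> eta0; rewrite /Rintegral LE. Qed.

Let int1 : P.-integrable setT (EFin \o (fun=> 1 : R)).
Proof. exact: finite_measure_integrable_cst. Qed.

Let Rint1 : \int[P]_w (1 : R) = 1.
Proof.
have PT : (P setT = 1)%E by exact: probability_setT.
by rewrite Rintegral_cst// [X in fine X]PT mulr1.
Qed.

Let mq n : measurable_fun setT (fun w => q n (Y w)).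
Proof.
apply: measurable_funM => //; apply: measurable_funB => //.
exact: measurable_expRNM.
Qed.

Let qC n w : 0 <= q n (Y w) <= (2^-1 ^+ n)^-1.
Proof.
by rewrite q_ge0// ler_pdivrMr// mulVf ?gt_eqF// lerBlDr lerDl expR_ge0.
Qed.

(** Shared by both moments: [g] expresses the integral of the [p]-th power of the quotient through
    the step, and monotone convergence identifies its limit at 0 with the [p]-th moment. *)
Let int_cvg (g : R -> R) (m : R) (p : nat) :
  (forall n, \int[P]_w (q n (Y w) ^+ p) = g (2^-1 ^+ n)) ->
  g eta @[eta --> 0^'+] --> m ->
  (\int[P]_w (Y w ^+ p)%:E = m%:E)%E.
Proof.
move=> qE /cvg_at_rightP/(_ (fun n => 2^-1 ^+ n)) gm.
have {}gm : (g (2^-1 ^+ n))%:E @[n --> \oo] --> m%:E.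
  by apply/cvg_EFin; [exact: nearW|exact: gm].
have mqp n : measurable_fun setT (fun w => (q n (Y w) ^+ p)).
  exact: measurable_funX.
have intE n : (\int[P]_w (q n (Y w) ^+ p)%:E = (g (2^-1 ^+ n))%:E)%E.
  rewrite -qE /Rintegral fineK//; apply: integrable_fin_num => //.
  apply: (@probability_integrable_bounded _ _ _ P _
    ((2^-1 ^+ n)^-1 ^+ p)) => // w.
  have /andP[q0 qc] := qC n w.
  by rewrite exprn_ge0//= lerXn2r// nnegrE// invr_ge0 ltW.
rewrite (_ : (fun n => (g _)%:E) =
  (fun n => \int[P]_w (q n (Y w) ^+ p)%:E)%E) in gm; last first.
  by apply/funext => n; rewrite intE.
transitivity (\int[P]_x limn (fun n => (q n (Y x) ^+ p)%:E))%E.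
  apply: eq_integral => w _; apply/esym/cvg_lim => //.
  apply/cvg_EFin; first exact: nearW.
  apply: (@continuous_cvg _ _ _ \oo _ (q ^~ (Y w)) (fun x : R => x ^+ p)).
    exact: exprn_continuous.
  exact: q_cvg.
apply: cvg_unique gm => //; apply: cvg_monotone_convergence => //.
- by move=> n; apply/measurable_EFinP.
- by move=> n w _; rewrite lee_fin exprn_ge0// q_ge0.
- move=> w _ i j ij; rewrite lee_fin lerXn2r// ?nnegrE ?q_ge0//.
  exact: q_nd.
Qed.

Lemma integral_laplace1 (m : R) :
  (1 - L eta) / eta @[eta --> 0^'+] --> m ->
  (\int[P]_w (Y w)%:E = m%:E)%E.
Proof.
move=> Lm; rewrite -(int_cvg (p := 1) _ Lm)//= => n.
under eq_Rintegral do rewrite expr1 /q mulrC.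
rewrite RintegralZl//; last first.
  exact: (integrableB measurableT int1 (integ (eta_gt0 n))).
by rewrite RintegralB// ?Rint1 ?RintE 1?mulrC//; exact: integ.
Qed.

(** Expanding [(1 - e^(- eta y))^2] and integrating produces the second difference of the transform
    at 0, with value 1 at 0. *)
Lemma integral_laplace2 (m : R) :
  (1 - 2 * L eta + L (2 * eta)) / eta ^+ 2 @[eta --> 0^'+] --> m ->
  (\int[P]_w (Y w ^+ 2)%:E = m%:E)%E.
Proof.
move=> Lm; apply: int_cvg Lm => n.
set e := 2^-1 ^+ n; have e0 : 0 < e by exact: eta_gt0.
transitivity (\int[P]_w ((e ^+ 2)^-1 *
    (1 - 2 * expR (- (e * Y w)) + expR (- (2 * e * Y w))))).
  apply: eq_Rintegral => w _; rewrite /q -/e.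
  have -> : expR (- (2 * e * Y w)) = expR (- (e * Y w)) ^+ 2.
    by rewrite expr2 -expRD; congr expR; ring.
  by field; rewrite gt_eqF.
have e20 : 0 < 2 * e by rewrite mulr_gt0.
have i1 : P.-integrable setT (EFin \o (fun w => 2 * expR (- (e * Y w)))).
  exact: (integrableZl measurableT 2 (integ e0)).
have i2 : P.-integrable setT (EFin \o (fun w => 1 - 2 * expR (- (e * Y w)))).
  exact: (integrableB measurableT int1 i1).
rewrite RintegralZl//; last exact: (integrableD measurableT i2 (integ e20)).
rewrite RintegralD//; last exact: integ.
rewrite RintegralB// RintegralZl//; last exact: integ.
by rewrite !RintE// Rint1 mulrC.
Qed.

End laplace_moments.

(** * The generalized counting process *)

(** In the factorisation of [a^n - b^n] the cofactor of [a - b] is a sum of [n] products in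
    [[0, 1]]. *)
Lemma normrXB_le {R : realDomainType} (a b : R) (n : nat) :
  0 <= a <= 1 -> 0 <= b <= 1 -> `|a ^+ n - b ^+ n| <= n%:R * `|a - b|.
Proof.
move=> /andP[a0 a1] /andP[b0 b1]; rewrite subrXX normrM mulrC.
apply: ler_wpM2r => //; apply: (le_trans (ler_norm_sum _ _ _)).
rewrite -[X in _ <= X%:R]card_ord -sum1_card natr_sum.
apply: ler_sum => i _; rewrite ger0_norm ?mulr_ge0 ?exprn_ge0//.
by rewrite mulr_ile1 ?exprn_ge0 ?exprn_ile1.
Qed.

(** Both [g] and the exponential are multiplicative, so their values at [t] are [n]-th powers of
    their values at [t / n]. The powers differ by at most [n] times the difference at [t / n], which
    is [n * o(t / n)] because the two functions agree to first order at 0. *)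
Lemma multiplicative_expR {R : realType} (g : R -> R) (c : R) :
  0 <= c -> g 0 = 1 -> (forall t, 0 <= t -> 0 <= g t <= 1) ->
  (forall s t, 0 <= s -> 0 <= t -> g (s + t) = g s * g t) ->
  (g h - (1 - c * h)) / h @[h --> 0^'+] --> 0 ->
  forall t, 0 <= t -> g t = expR (- (c * t)).
Proof.
move=> c0 g0 g01 gD gc t; rewrite le_eqVlt => /predU1P[<-|t0].
  by rewrite mulr0 oppr0 expR0.
pose e (h : R) := expR (- (c * h)).
have ec : (e h - (1 - c * h)) / h @[h --> 0^'+] --> 0.
  have de : is_derive (0 : R) 1 (fun h => e h + c * h) 0.
    rewrite /e; apply: is_derive_eq.
    by rewrite mulr0 oppr0 expR0; cbn; ring.
  have := is_derive_cvg_at_right de.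
  rewrite {2}/e !mulr0 oppr0 expR0 addr0.
  rewrite (_ : (fun h => _) = (fun h => (e h - (1 - c * h)) / h))//.
  by apply/funext => h; rewrite add0r; congr (_ / _); ring.
have gX n h : 0 <= h -> g (n%:R * h) = g h ^+ n.
  move=> h0; elim: n => [|n IH]; first by rewrite mul0r g0 expr0.
  by rewrite -natr1 mulrDl mul1r gD ?mulr_ge0// IH exprSr.
have geh : (g h - e h) / h @[h --> 0^'+] --> 0.
  rewrite -[X in _ --> X](subr0 0).
  rewrite (_ : (fun h => _) = (fun h => (g h - (1 - c * h)) / h -
      (e h - (1 - c * h)) / h)); first exact: cvgB.
  by apply/funext => h; rewrite -mulrBl; congr (_ / _); ring.
have hn : t / n.+1%:R @[n --> \oo] --> 0.
  rewrite -[X in _ --> X](mulr0 t); apply: cvgM; first exact: cvg_cst.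
  exact: cvg_harmonic.
move/cvg_at_rightP : geh => /(_ (fun n => t / n.+1%:R)) geh.
have {}geh : `|(g (t / n.+1%:R) - e (t / n.+1%:R)) / (t / n.+1%:R)| * t
    @[n --> \oo] --> 0.
  have /cvg_norm : (g (t / n.+1%:R) - e (t / n.+1%:R)) / (t / n.+1%:R)
      @[n --> \oo] --> 0.
    by apply: geh; split=> // n; rewrite divr_gt0.
  rewrite normr0 -[in X in _ -> X](mul0r t) => H.
  by apply: cvgM; [exact: H|exact: cvg_cst].
(* It remains to bound the fixed number [|g t - e t|] by each term of the null sequence [geh]. *)
apply/eqP; rewrite -subr_eq0 -normr_le0; apply: (cvgr_to_ge geh).
apply: nearW => n.
have n0 : (n.+1%:R : R) != 0 by rewrite pnatr_eq0.
have tn0 : 0 <= t / n.+1%:R by rewrite divr_ge0 ?ltW.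
have tE : t = n.+1%:R * (t / n.+1%:R) by rewrite mulrC divfK.
rewrite {1 2}tE gX// (_ : expR _ = e (t / n.+1%:R) ^+ n.+1); last first.
  by rewrite /e -expRM_natl; congr expR; field.
have e01 : 0 <= e (t / n.+1%:R) <= 1.
  exact: expRNM01.
apply: le_trans (normrXB_le n.+1 (g01 _ tn0) e01) _.
rewrite normrM [X in _ <= _ * X * _]gtr0_norm ?invr_gt0 ?divr_gt0//.
rewrite le_eqVlt; apply/orP; left; apply/eqP; field.
by rewrite ?pnatr_eq0 ?gt_eqF.
Qed.

Lemma ge0_integral_same_law {R : realType} {d : measure_display}
    {T : measurableType d} (P : probability T R) (U V : T -> R) (f : R -> R) :
  measurable_fun setT U -> measurable_fun setT V -> measurable_fun setT f ->
  (forall x, 0 <= f x) ->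
  (forall B, measurable B -> P (U @^-1` B) = P (V @^-1` B)) ->
  (\int[P]_w (f (U w))%:E = \int[P]_w (f (V w))%:E)%E.
Proof.
move=> mU mV mf f0 UV.
have push (W : T -> R) (mW : measurable_fun setT W) :
    (\int[P]_w (f (W w))%:E = \int[pushforward P W]_y (f y)%:E)%E.
  rewrite (ge0_integral_pushforward mW) ?preimage_setT//.
    exact/measurable_EFinP.
  by move=> y _; rewrite lee_fin.
by rewrite !push//; apply: eq_measure_integral => B mB _; exact: UV.
Qed.

(** * Single increments of a Levy process *)

Section levy.
Context {R : realType} {d : measure_display} {T : measurableType d}.
Variables (P : probability T R) (X : R -> T -> R).
Hypothesis hX : levy_process P X.

Lemma levy_increment_integral (f : R -> R) (s t : R) :
  measurable_fun setT f -> (forall x, 0 <= f x) -> 0 <= s -> 0 <= t ->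
  (\int[P]_w (f (X (s + t) w - X s w))%:E = \int[P]_w (f (X t w))%:E)%E.
Proof.
move=> mf f0 s0 t0; have mX := levy_measurable hX.
transitivity (\int[P]_w (f (X t w - X 0 w))%:E)%E.
  apply: (@ge0_integral_same_law _ _ _ P (fun w => X (s + t) w - X s w)
    (fun w => X t w - X 0 w)) => //.
  - by apply: measurable_funB; apply: mX => //; exact: addr_ge0.
  - by apply: measurable_funB; apply: mX.
  - by move=> B mB; exact: (levy_stationary_increments hX).
by apply: eq_integral => w _; rewrite (levy_start hX) subr0.
Qed.

Lemma levy_increment_indep (s t : R) (A B : set R) :
  0 <= s -> 0 <= t -> measurable A -> measurable B ->
  P (X s @^-1` A `&` (fun w => X (s + t) w - X s w) @^-1` B) =
  (P (X s @^-1` A) * P ((fun w => (X (s + t) w - X s w)%R) @^-1` B))%E.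
Proof.
move=> s0 t0 mA mB.
(* The times 0, [s], [s + t], constant afterwards: the first increment is [X s] itself since paths
   start at 0. *)
pose tau (n : nat) := if n is n.+1 then if n is _.+1 then s + t else s else 0.
have tau_homo : {homo tau : i j / (i <= j)%N >-> i <= j}.
  move=> [|[|i]] [|[|j]] //= _; first exact: addr_ge0.
  by rewrite lerDl.
pose D (i : 'I_2) := if i == ord0 then A else B.
have mD i : measurable (D i) by rewrite /D; case: ifP.
have := levy_independent_increments hX (n := 2) (lexx 0) tau_homo mD.
have X0 w : X 0 w = 0 := levy_start hX w.
rewrite !big_ord_recl big_ord0 mule1 /D/=.
rewrite (_ : (fun w => X s w - X 0 w) = X s) => [<-|]; last first.
  by apply/funext => w; rewrite X0 subr0.
congr (P _).
apply/seteqP; split=> w /=.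
  move=> [Aw Bw] [[|[|//]] i2] _ /=.
    by rewrite /D/= X0 subr0.
  by rewrite /D.
move=> H; split.
  by have := H ord0 I; rewrite /= X0 subr0.
by have := H (lift ord0 ord0) I.
Qed.

End levy.

(** * Laplace transform of the counting process *)

Section counting.
Context {R : realType} {d : measure_display} {T : measurableType d}.
Variables (P : probability T R) (k : nat) (lambda : nat -> R) (M : R -> T -> R).
Hypothesis hlambda : forall j, (1 <= j <= k)%N -> 0 < lambda j.
Hypothesis hM : generalized_counting_process P k lambda M.

Let mM t : 0 <= t -> measurable_fun setT (M t).
Proof. by move=> t0; exact: (levy_measurable (gcp_levy hM)). Qed.

Lemma gcp_ge0 t w : 0 <= t -> 0 <= M t w.
Proof. by move=> t0; have [n ->] := gcp_nat hM w t0. Qed.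

Lemma gcp_integrable eta t : 0 <= eta -> 0 <= t ->
  P.-integrable setT (EFin \o (fun w => expR (- (eta * M t w)))).
Proof.
move=> e0 t0; apply: (@probability_integrable_bounded _ _ _ _ _ 1).
  exact/measurable_expRNM/mM.
by move=> w; apply: expRNM01 => //; exact: gcp_ge0.
Qed.

Let g eta t := \int[P]_w expR (- (eta * M t w)).

Let gE eta t : 0 <= eta -> 0 <= t ->
  (\int[P]_w (expR (- (eta * M t w)))%:E = (g eta t)%:E)%E.
Proof.
move=> e0 t0; rewrite /g /Rintegral fineK//.
by apply: integrable_fin_num => //; exact: gcp_integrable.
Qed.

Let PT : (P setT = 1)%E. Proof. exact: probability_setT. Qed.

Let g0 eta : g eta 0 = 1.
Proof.
rewrite /g; under eq_Rintegral do
  rewrite (levy_start (gcp_levy hM)) mulr0 oppr0 expR0.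
by rewrite Rintegral_cst// [X in fine X]PT mulr1.
Qed.

Let g01 eta t : 0 <= eta -> 0 <= t -> 0 <= g eta t <= 1.
Proof.
move=> e0 t0; apply/andP; split.
  by apply: Rintegral_ge0 => w _; rewrite expR_ge0.
have <- : \int[P]_w (1 : R) = 1.
  by rewrite Rintegral_cst// [X in fine X]PT mulr1.
apply: le_Rintegral => //; first exact: gcp_integrable.
  exact: finite_measure_integrable_cst.
by move=> w _; have /andP[] := expRNM01 e0 (gcp_ge0 w t0).
Qed.

(** The semigroup property: [M s] takes values in the natural numbers, so one can condition on it by
    a countable sum. The following increment is independent of it and distributed as [M t]. *)
Let gD eta s t : 0 <= eta -> 0 <= s -> 0 <= t ->
  g eta (s + t) = g eta s * g eta t.
Proof.
move=> e0 s0 t0; have st0 : 0 <= s + t by exact: addr_ge0.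
pose kappa w := Num.truncn (M s w).
have MsE w : M s w = (kappa w)%:R.
  by rewrite /kappa; have [n ->] := gcp_nat hM w s0; rewrite natrK.
have kE n : kappa @^-1` [set n] = M s @^-1` [set n%:R].
  apply/seteqP; split=> w /=; rewrite MsE; first by move=> ->.
  by move/eqP; rewrite eqr_nat => /eqP.
pose Z n w := expR (- (eta * (n%:R + (M (s + t) w - M s w)))).
have mI : measurable_fun setT (fun w => M (s + t) w - M s w).
  by apply: measurable_funB; exact: mM.
pose f n (x : R) := expR (- (eta * (n%:R + x))).
have mf n : measurable_fun setT (f n).
  by apply: measurable_expRNM; exact: measurable_funD.
have fE n x : f n x = expR (- (eta * n%:R)) * expR (- (eta * x)).
  by rewrite /f -expRD; congr expR; ring.
apply: EFin_inj; rewrite -gE//.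
transitivity (\int[P]_w (expR (- (eta * (kappa w)%:R)) * g eta t)%:E)%E;
    last first.
  rewrite mulrC EFinM -(gE e0 s0) -ge0_integralZl//.
  - by apply: eq_integral => w _; rewrite MsE EFinM muleC.
  - by apply/measurable_EFinP; exact/measurable_expRNM/mM.
  - by have /andP[] := g01 e0 t0.
rewrite -(@ge0_integral_countable_indep _ _ _ P nat kappa Z
  (fun n => expR (- (eta * n%:R)) * g eta t)).
- by apply: eq_integral => w _; rewrite /Z -MsE subrKC.
- by move=> n; rewrite kE -[X in measurable X]setTI; exact: mM.
- move=> n; apply: measurable_expRNM; exact: measurable_funD.
- by move=> n w; exact: expR_ge0.
- move=> n B mB; rewrite kE.
  rewrite (_ : Z n @^-1` B =
    (fun w => M (s + t) w - M s w) @^-1` (f n @^-1` B))//.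
  apply: (levy_increment_indep (gcp_levy hM)) => //.
  by rewrite -[X in measurable X]setTI; exact: mf.
- move=> w'; set n := kappa w'.
  rewrite /Z (levy_increment_integral (gcp_levy hM) (f := f n))//; last first.
    by move=> x; exact: expR_ge0.
  under eq_integral do rewrite fE EFinM.
  rewrite ge0_integralZl//.
  + by rewrite gE// EFinM.
  + by apply/measurable_EFinP; exact/measurable_expRNM/mM.
Qed.

(** The exponent of the probability generating function at [u = e^(- eta)]. *)
Definition gcp_exponent eta : R :=
  \sum_(1 <= j < k.+1) lambda j * (1 - expR (- (eta * j%:R))).

Lemma gcp_exponent_ge0 eta : 0 <= eta -> 0 <= gcp_exponent eta.
Proof.
move=> e0; rewrite /gcp_exponent big_nat; apply: sumr_ge0 => j jk.
apply: mulr_ge0; first exact/ltW/hlambda.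
by rewrite subr_ge0; have /andP[] := expRNM01 e0 (ler0n _ j).
Qed.

Let p h j := fine (P [set w | M h w = j%:R]).

(** The error of the first-order expansion of the law of [M h], for jump sizes up to [k]. *)
Let r h j := p h j -
  (if j is 0%N then 1 - total_rate k lambda * h else lambda j * h).

Let mMj h j : 0 <= h -> measurable [set w | M h w = j%:R].
Proof.
move=> h0; rewrite -[X in measurable X]setTI.
exact: (mM h0 measurableT (measurable_set1 _)).
Qed.

Let r_small j (e : R) : (j < k.+1)%N -> 0 < e ->
  \forall h \near 0^'+, `|r h j| <= e * h.
Proof.
move=> jk e0.
have M0 : [set w | M 0 w = 0%:R] = setT.
  by apply/seteqP; split=> // w _; rewrite /= (levy_start (gcp_levy hM)).
(* Starting from time 0 and state 0 the conditioning event is the whole space, so the conditional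
   probability is [p h j]. *)
have := @gcp_transition _ _ _ _ _ _ _ hM 0 0 j (lexx 0).
rewrite M0 PT => /(_ (oner_neq0 _)).
have pE :
    (fun h => cond_prob P [set w | M (0 + h) w = (0 + j)%:R] setT) = p ^~ j.
  apply/funext => h; rewrite /cond_prob setIT PT/= divr1 add0r add0n//.
rewrite pE => -[H0 H1 _].
have fin (f : R -> R) : f =o_ (0^'+) (fun h : R => h) ->
    \forall h \near 0^'+, `|f h| <= e * h.
  move/eqoP => /(_ _ e0); apply: filterS2 (nbhs_right_gt 0) => h h0.
  by rewrite (gtr0_norm h0).
case: j jk H0 H1 pE => [|j] jk H0 H1 pE; apply: fin; first exact: H0.
by apply: H1.
Qed.

Let ind h j w : R := \1_[set w | M h w = j%:R] w.

Let sum_ind h (b : nat -> R) (n : nat) w : M h w = n%:R ->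
  \sum_(j < k.+1) b j * ind h j w = if (n < k.+1)%N then b n else 0.
Proof.
move=> Mn; have indE j : ind h j w = (j == n)%:R.
  rewrite /ind indicE; congr (nat_of_bool _)%:R.
  rewrite -[RHS](@eqr_nat R) eq_sym -Mn.
  by apply/idP/eqP; rewrite inE.
under eq_bigr do rewrite indE.
case: ltnP => nk.
  rewrite (bigD1 (Ordinal nk))//= eqxx mulr1 big1 ?addr0// => i.
  by rewrite -val_eqE/= => /negbTE->; rewrite mulr0.
rewrite big1// => i _; rewrite (ltn_eqF (leq_trans (ltn_ord i) nk)) mulr0//.
Qed.

Let ind_int h j : 0 <= h -> P.-integrable setT (EFin \o ind h j).
Proof. by move=> h0; apply: integrable_indic; exact: mMj. Qed.

Let int_sum_ind h (b : nat -> R) : 0 <= h ->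
  \int[P]_w (\sum_(j < k.+1) b j * ind h j w) = \sum_(j < k.+1) b j * p h j.
Proof.
move=> h0; rewrite Rintegral_sum//; last first.
  by move=> j; exact: (integrableZl measurableT (b j) (ind_int j h0)).
apply: eq_bigr => j _; rewrite RintegralZl//; last exact: ind_int.
congr (_ * _); rewrite /p /Rintegral integral_indic ?setIT//.
exact: mMj.
Qed.

Let sum_int h (b : nat -> R) : 0 <= h ->
  P.-integrable setT (EFin \o (fun w => \sum_(j < k.+1) b j * ind h j w)).
Proof.
move=> h0; rewrite (_ : _ \o _ =
    fun w => (\sum_(j < k.+1) (b j * ind h j w)%:E)%E); last first.
  by apply/funext => w /=; rewrite sumEFin.
apply: integrable_sum => // j _.
exact: (integrableZl measurableT (b j) (ind_int j h0)).
Qed.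

Let sum_p h (b : nat -> R) : \sum_(j < k.+1) b j * p h j =
  b 0%N * (1 - total_rate k lambda * h) +
  (\sum_(1 <= j < k.+1) lambda j * b j) * h + \sum_(j < k.+1) b j * r h j.
Proof.
rewrite -!(big_mkord xpredT (fun j => b j * _ h j)) !(big_ltn (ltn0Sn k)).
have -> : \sum_(1 <= j < k.+1) b j * p h j =
    (\sum_(1 <= j < k.+1) lambda j * b j) * h +
    \sum_(1 <= j < k.+1) b j * r h j.
  rewrite mulr_suml -big_split/=; apply: eq_big_nat => -[//|j] _.
  by rewrite /r; ring.
by rewrite /r; ring.
Qed.

(** The integrand lies between [S a], the contribution of the values up to [k], and [S a] plus the
    indicator of [M h > k]. By complement that event has probability minus the sum of the [r h j].
    Each of the two error sums is at most the sum of the [|r h j|]. *)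
Let g_bound eta h : 0 <= eta -> 0 <= h ->
  `|g eta h - (1 - gcp_exponent eta * h)| <= 2 * \sum_(j < k.+1) `|r h j|.
Proof.
move=> e0 h0.
pose a j := expR (- (eta * j%:R)).
have a01 j : 0 <= a j <= 1 by exact: expRNM01.
pose S b w := \sum_(j < k.+1) b j * ind h j w.
have lo : \int[P]_w S a w <= g eta h.
  apply: le_Rintegral => //; [exact: sum_int|exact: gcp_integrable|].
  move=> w _; have [n Mn] := gcp_nat hM w h0.
  rewrite /S (sum_ind _ Mn) Mn; case: ifP => // _; exact: expR_ge0.
have i1 : P.-integrable setT (EFin \o (fun=> 1 : R)).
  exact: finite_measure_integrable_cst.
have i2 := sum_int (fun=> 1) h0.
have i3 := integrableB measurableT i1 i2.
have hi : g eta h <= \int[P]_w (S a w + (1 - S (fun=> 1) w)).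
  apply: le_Rintegral => //; first exact: gcp_integrable.
    exact: (integrableD measurableT (sum_int a h0) i3).
  move=> w _; have [n Mn] := gcp_nat hM w h0.
  rewrite /S (sum_ind a Mn) (sum_ind (fun=> 1) Mn) Mn.
  case: ifP => _ /=; first by rewrite subrr addr0.
  by rewrite add0r subr0; have /andP[] := a01 n.
have I1 : \int[P]_w S (fun=> 1) w = 1 + \sum_(j < k.+1) r h j.
  rewrite (int_sum_ind (fun=> 1) h0) (sum_p h (fun=> 1)).
  under eq_bigr do rewrite mulr1.
  under [X in _ + _ + X = _]eq_bigr do rewrite mul1r.
  by rewrite /total_rate; ring.
have Ia : \int[P]_w S a w = \sum_(j < k.+1) a j * p h j by exact: int_sum_ind.
move: lo hi; rewrite RintegralD//; last exact: sum_int.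
rewrite RintegralB// Ia I1 sum_p Rintegral_cst// [X in fine X]PT.
have -> : a 0%N = 1 by rewrite /a mulr0 oppr0 expR0.
have eE : gcp_exponent eta =
    total_rate k lambda - \sum_(1 <= j < k.+1) lambda j * a j.
  rewrite /gcp_exponent /total_rate -sumrB; apply: eq_bigr => j _.
  by rewrite mulrBr mulr1.
have B1 : `|\sum_(j < k.+1) a j * r h j| <= \sum_(j < k.+1) `|r h j|.
  apply: (le_trans (ler_norm_sum _ _ _)); apply: ler_sum => j _.
  rewrite normrM ler_piMl// ger0_norm; by have /andP[] := a01 j.
have B2 : `|\sum_(j < k.+1) r h j| <= \sum_(j < k.+1) `|r h j|.
  exact: ler_norm_sum.
rewrite eE; move: B1 B2; rewrite !ler_norml => /andP[B1 B1'] /andP[B2 B2'].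
move=> lo hi; have f1 : fine (1%E : \bar R) = 1 by [].
by rewrite f1 in hi; apply/andP; split; lra.
Qed.

Lemma gcp_laplace eta t : 0 <= eta -> 0 <= t ->
  (\int[P]_w (expR (- (eta * M t w)))%:E =
   (expR (- (gcp_exponent eta * t)))%:E)%E.
Proof.
move=> e0 t0; rewrite gE//; congr EFin.
apply: multiplicative_expR t0 => //.
- exact: gcp_exponent_ge0.
- by move=> u; exact: g01.
- by move=> s u; exact: gD.
apply/cvgrPdist_le => e ep.
(* The bound is twice a sum of [k + 1] errors. *)
pose e' := e / (2 * k.+1%:R).
have e'0 : 0 < e' by rewrite divr_gt0// mulr_gt0.
have : \forall h \near 0^'+, (forall j : 'I_k.+1, `|r h j| <= e' * h).
  by apply: filter_forall => j; exact: r_small.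
apply: filterS2 (nbhs_right_gt 0) => h h0 rh.
rewrite sub0r normrN normrM normfV (gtr0_norm h0) ler_pdivrMr//.
apply: le_trans (g_bound e0 (ltW h0)) _.
apply: (@le_trans _ _ (2 * \sum_(j < k.+1) e' * h)).
  by rewrite ler_pM2l//; apply: ler_sum => j _; exact: rh.
rewrite sumr_const card_ord -[_ *+ k.+1]mulr_natr /e' le_eqVlt.
apply/orP; left; apply/eqP.
have : (k.+1%:R : R) != 0 by rewrite pnatr_eq0.
by move: (k.+1%:R : R) => n n0; field.
Qed.

End counting.

(** * The Laplace exponent of the subordinator *)

Section phi_analysis.
Context {R : realType}.
Implicit Types alpha theta x y : R.
Notation mu := (@lebesgue_measure R).

(** The possible singularity at 0 is exhausted by the intervals [[b / (n + 1), b]]. On each of them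
    the antiderivative [x^alpha / alpha] gives the same bound [b^alpha / alpha], which passes to the
    union by monotone convergence. *)
Lemma integrable_powR alpha b : 0 < alpha -> 0 < b ->
  mu.-integrable `]0, b] (EFin \o (fun x => x `^ (alpha - 1))).
Proof.
move=> a0 b0; apply/integrableP; split.
  by apply/measurable_EFinP; apply: measurable_funTS; exact: measurable_powR.
pose F n : set R := `[b / n.+1%:R, b]%classic.
have FE : `]0, b]%classic = \bigcup_n F n.
  apply/seteqP; split=> x /=; rewrite in_itv/=.
    move=> /andP[x0 xb]; exists (Num.truncn (b / x)) => //=.
    rewrite /F/= in_itv/= xb andbT ler_pdivrMr// mulrC -ler_pdivrMr//.
    by rewrite ltW// truncnS_gt.
  move=> [n _]; rewrite /F/= in_itv/= => /andP[xn ->]; rewrite andbT.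
  by rewrite (lt_le_trans _ xn)// divr_gt0.
rewrite FE.
have Fle n : (\int[mu]_(x in F n) `|(x `^ (alpha - 1))%:E| <=
    (b `^ alpha / alpha)%:E)%E.
  (* For index 0 the interval degenerates to the point [b], which is handled apart from the
     fundamental theorem of calculus. *)
  case: n => [|n].
    by rewrite /F divr1 set_itv1 integral_set1 lee_fin divr_ge0 ?powR_ge0// ltW.
  have bn0 : 0 < b / n.+2%:R by rewrite divr_gt0.
  have bnb : b / n.+2%:R < b by rewrite ltr_pdivrMr// ltr_pMr// ltr1n.
  have -> : (\int[mu]_(x in F n.+1) `|(x `^ (alpha - 1))%:E| =
     \int[mu]_(x in F n.+1) (x `^ (alpha - 1))%:E)%E.
    by apply: eq_integral => x _; rewrite gee0_abs// lee_fin powR_ge0.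
  have dF x : 0 < x ->
      is_derive x 1 (fun x => x `^ alpha / alpha) (x `^ (alpha - 1)).
    move=> x0; have := is_derive1_powR alpha x0 => dx.
    apply: is_derive_eq.
    by rewrite scaler0 add0r [_ *: _]mulrA mulVf ?mul1r// gt_eqF.
  have dc x : 0 < x -> {for x, continuous (fun x => x `^ alpha / alpha)}.
    move=> x0; apply: differentiable_continuous; apply/derivable1_diffP.
    by have [] := dF _ x0.
  rewrite /F (continuous_FTC2 (F := fun x => x `^ alpha / alpha))//.
  - by rewrite -EFinB lee_fin lerBlDr lerDl divr_ge0 ?powR_ge0// ltW.
  - apply: continuous_in_subspaceT => x; rewrite inE/= in_itv/= => /andP[bx _].
    have x0 : 0 < x by exact: lt_le_trans bx.
    apply: differentiable_continuous; apply/derivable1_diffP.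
    by have [] := is_derive1_powR (alpha - 1) x0.
  - split.
    + move=> x; rewrite in_itv/= => /andP[bx _].
      by have [] := dF _ (lt_trans bn0 bx).
    + by apply: cvg_at_right_filter; exact: dc.
    + by apply: cvg_at_left_filter; exact: dc.
  - move=> x; rewrite in_itv/= => /andP[bx _].
    by rewrite derive1E; have [_ ->] := dF _ (lt_trans bn0 bx).
rewrite (@le_lt_trans _ _ ((b `^ alpha / alpha)%:E))// ?ltry//.
pose f (x : R) : \bar R := `|(x `^ (alpha - 1))%:E|%E.
have mf : measurable_fun setT f.
  apply: measurableT_comp => //.
  by apply/measurable_EFinP; exact: measurable_powR.
have F_nd : {homo F : n m / (n <= m)%N >-> (n <= m)%O}.
  move=> i j ij; apply/subsetPset; apply: subset_itvr.
  by rewrite bnd_simp ler_pM2l// lef_pV2 ?posrE// ler_nat.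
have F_cvg : (\int[mu]_(x in F n) f x @[n --> \oo] -->
    \int[mu]_(x in \bigcup_i F i) f x)%E.
  apply: (@ge0_nondecreasing_set_cvg_integral _ (measurableTypeR R) R F f).
  - exact: F_nd.
  - by move=> n; exact: measurable_itv.
  - by move=> n; exact: measurable_funTS.
  - by move=> n x _; exact: abse_ge0.
apply: (cvge_le _ F_cvg); apply: nearW; exact: Fle.
Qed.

Lemma integrable_gamma alpha b : 0 < alpha -> 0 < b ->
  mu.-integrable `]0, b] (EFin \o (fun x => expR (- x) * x `^ (alpha - 1))).
Proof.
move=> a0 b0; apply: le_integrable (integrable_powR a0 b0) => //.
  apply/measurable_EFinP; apply: measurable_funTS; apply: measurable_funM.
    by apply: measurableT_comp => //; exact: measurable_oppr.
  exact: measurable_powR.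
move=> x /=; rewrite in_itv/= => /andP[x0 _].
rewrite lee_fin !ger0_norm ?powR_ge0// ?mulr_ge0 ?expR_ge0 ?powR_ge0//.
by rewrite ler_piMl ?powR_ge0// -expR0 ler_expR oppr_le0 ltW.
Qed.

Lemma is_derive_lower_gamma alpha y : 0 < alpha -> 0 < y ->
  is_derive y 1 (lower_gamma alpha) (expR (- y) * y `^ (alpha - 1)).
Proof.
(* The point [y + 1] only serves to make [y] interior to the interval of integrability. *)
move=> a0 y0; have y1 : y < y + 1 by rewrite ltrDl.
have y10 : 0 < y + 1 by rewrite addr_gt0.
have := @continuous_FTC1 R (fun x => expR (- x) * x `^ (alpha - 1))
  (BRight 0) y (y + 1) y1 (integrable_gamma a0 y10).
move=> /(_ _ _)/= [].
- by rewrite lte_fin.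
- have := is_derive1_powR (alpha - 1) y0 => dp.
  by apply: differentiable_continuous; apply/derivable1_diffP; exact: ex_derive.
- move=> dF dFE; apply: DeriveDef; first exact: dF.
  by rewrite -derive1E -dFE.
Qed.

(** For positive [theta] the range of [x] contains a neighbourhood of 0: tempering makes the
    exponent differentiable there from both sides, which yields finite moments. *)
Lemma is_derive_phi alpha theta x : 0 < alpha -> - theta < x ->
  is_derive x 1 (phi alpha theta)
    (alpha * (expR (- (x + theta)) * (x + theta) `^ (alpha - 1))).
Proof.
move=> a0 xt; have xt0 : 0 < x + theta by rewrite -(opprK theta) subr_gt0.
have dg := is_derive_lower_gamma a0 xt0.
have ds : is_derive x 1 (fun x => x + theta) 1.
  by apply: is_derive_eq; rewrite addr0.
have := is_derive1_comp (g := fun x => x + theta) dg ds.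
rewrite /comp mulr1 => dc.
by rewrite /phi; apply: is_derive_eq; rewrite subr0.
Qed.

End phi_analysis.

(** * Time change by a subordinator *)

(** The generating class of [sigma_process], named so that [g_sigma_algebraType] equips the sample
    space with that sigma-algebra and the usual measurability lemmas apply to it. *)
Definition process_generators {R : realType} {d : measure_display}
    {T : measurableType d} (X : R -> T -> R) : set (set T) :=
  [set A | exists t, exists B : set R,
     [/\ 0 <= t, measurable B & A = X t @^-1` B]].

Lemma measurable_sigma_process {R : realType} {d : measure_display}
    {T : measurableType d} (X : R -> T -> R) (t : R) : 0 <= t ->
  measurable_fun setT (X t : g_sigma_algebraType (process_generators X) -> R).
Proof.
move=> t0 _ B mB; rewrite setTI; apply: sub_sigma_algebra.
by exists t, B.
Qed.

Section subordination.
Context {R : realType} {d : measure_display} {T : measurableType d}.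
Variables (P : probability T R) (M G : R -> T -> R).
Hypotheses (hM : levy_process P M) (hG : levy_process P G).
Hypothesis G_nd : forall w s t, 0 <= s -> s <= t -> G s w <= G t w.

Let mM t : 0 <= t -> measurable_fun setT (M t).
Proof. by move=> t0; exact: (levy_measurable hM). Qed.

Let mG t : 0 <= t -> measurable_fun setT (G t).
Proof. by move=> t0; exact: (levy_measurable hG). Qed.

Lemma subordinator_ge0 t w : 0 <= t -> 0 <= G t w.
Proof. by move=> t0; rewrite -(levy_start hG w) G_nd. Qed.

(* The subordinator is approximated strictly from the right by processes with
   values in the grid of mesh [1 / N.+1], along which [M] converges. *)
Let grid (N i : nat) : R := i.+1%:R / N.+1%:R.
Let cell (N : nat) t w : nat := Num.truncn (N.+1%:R * G t w).

Let grid_ge0 N i : 0 <= grid N i. Proof. by rewrite divr_ge0. Qed.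

Let cellE N t i : 0 <= t -> cell N t @^-1` [set i] =
  G t @^-1` `[i%:R / N.+1%:R, i.+1%:R / N.+1%:R[%classic.
Proof.
move=> t0; apply/seteqP; split=> w /=.
all: rewrite in_itv/= ler_pdivrMr// ltr_pdivlMr// [G t w * _]mulrC.
all: rewrite -truncn_eq ?mulr_ge0 ?subordinator_ge0//.
  by move/eqP.
by move/eqP.
Qed.

Let grid_gt N t w : 0 <= t -> G t w < grid N (cell N t w).
Proof. by move=> t0; rewrite ltr_pdivlMr// mulrC truncnS_gt. Qed.

Let grid_le N t w : 0 <= t -> grid N (cell N t w) <= G t w + N.+1%:R^-1.
Proof.
move=> t0; rewrite /grid -natr1 mulrDl mul1r lerD2r ler_pdivrMr// mulrC.
by rewrite truncn_le mulr_ge0 ?subordinator_ge0.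
Qed.

Let grid_cvg t w : 0 <= t -> grid N (cell N t w) @[N --> \oo] --> G t w.
Proof.
move=> t0; apply: (@squeeze_cvgr _ _ _ _ (fun=> G t w)
    (fun N => G t w + N.+1%:R^-1)).
- by apply: nearW => N; rewrite ltW ?grid_gt//= grid_le.
- exact: cvg_cst.
- rewrite -[X in _ --> X]addr0; apply: cvgD; first exact: cvg_cst.
  exact: cvg_harmonic.
Qed.

(** Paths of [M] are right-continuous, and the limit from the right is over a punctured
    neighbourhood; this is why the grid points lie strictly above [G t w]. *)
Let M_grid_cvg t w : 0 <= t ->
  M (grid N (cell N t w)) w @[N --> \oo] --> M (G t w) w.
Proof.
move=> t0; have [rc _] := levy_cadlag hM w.
have /cvg_at_rightP := rc _ (subordinator_ge0 w t0).
by apply; split=> [N|]; [exact: grid_gt|exact: grid_cvg].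
Qed.

Let measurable_cell N t i : 0 <= t -> measurable (cell N t @^-1` [set i]).
Proof.
by move=> t0; rewrite cellE// -[X in measurable X]setTI; exact: mG.
Qed.

Let measurable_grid N t : 0 <= t ->
  measurable_fun setT (fun w => grid N (cell N t w)).
Proof.
move=> t0; apply: (measurable_fun_countable (Z := fun i _ => grid N i)) => i.
  exact: measurable_cell.
exact: measurable_cst.
Qed.

Let measurable_M_grid N t : 0 <= t ->
  measurable_fun setT (fun w => M (grid N (cell N t w)) w).
Proof.
move=> t0; apply: (measurable_fun_countable (Z := fun i => M (grid N i))) => i.
  exact: measurable_cell.
exact: mM.
Qed.

(** A pointwise limit of grid approximations, each glued from countably many measurable functions
    [M (grid N i)]. *)
Lemma measurable_subordinated t : 0 <= t ->
  measurable_fun setT (subordinated M G t).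
Proof.
move=> t0.
apply: (@measurable_fun_cvg _ _ _ setT (fun N w => M (grid N (cell N t w)) w)).
  by move=> N; exact: measurable_M_grid.
by move=> w _; exact: M_grid_cvg.
Qed.

Hypothesis hMG : independent_processes P M G.
Variables (eta psi : R).
Hypotheses (eta0 : 0 <= eta) (psi0 : 0 <= psi).
Hypothesis M_laplace : forall t, 0 <= t ->
  (\int[P]_w (expR (- (eta * `|M t w|)))%:E = (expR (- (psi * t)))%:E)%E.

(** The absolute values make the formula symmetric in [u] and [v], so the order of two grid points
    need not be tracked. *)
Let M_increment u v : 0 <= u -> 0 <= v ->
  (\int[P]_w (expR (- (eta * `|M v w - M u w|)))%:E =
   (expR (- (psi * `|v - u|)))%:E)%E.
Proof.
move=> u0 v0; wlog uv : u v u0 v0 / u <= v => [H|].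
  have [uv|/ltW vu] := leP u v; first exact: H.
  rewrite (distrC v u) -(H v u v0 u0 vu); apply: eq_integral => w _.
  by rewrite (distrC (M v w)).
pose f (x : R) := expR (- (eta * `|x|)).
have mf : measurable_fun setT f.
  by apply: measurable_expRNM; exact: normr_measurable.
have vu0 : 0 <= v - u by rewrite subr_ge0.
have := levy_increment_integral hM mf (fun x => expR_ge0 _) u0 vu0.
by rewrite subrKC /f M_laplace// ger0_norm.
Qed.

(** Conditioning on the pair of cells, which is determined by [G] and hence independent of the
    increments of [M]. *)
Let integral_grid N s t : 0 <= s -> 0 <= t ->
  (\int[P]_w (expR (- (eta * `|M (grid N (cell N t w)) w -
      M (grid N (cell N s w)) w|)))%:E =
   \int[P]_w (expR (- (psi * `|grid N (cell N t w) -
      grid N (cell N s w)|)))%:E)%E.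
Proof.
move=> s0 t0; pose kappa w := (cell N s w, cell N t w).
have kE i j : kappa @^-1` [set (i, j)] =
    cell N s @^-1` [set i] `&` cell N t @^-1` [set j].
  by apply/seteqP; split=> w; rewrite /kappa/= => -[-> ->].
pose Z (ij : nat * nat) w :=
  expR (- (eta * `|M (grid N ij.2) w - M (grid N ij.1) w|)).
apply: (@ge0_integral_countable_indep _ _ _ P _ kappa Z
  (fun ij => expR (- (psi * `|grid N ij.2 - grid N ij.1|)))).
- by move=> [i j]; rewrite kE; apply: measurableI; exact: measurable_cell.
- move=> [i j]; apply: measurable_expRNM; apply: measurableT_comp => //.
  by apply: measurable_funB; exact: mM.
- by move=> ij w; exact: expR_ge0.
- move=> [i j] B mB; rewrite setIC muleC; apply: hMG.
    (* Independence is available on the generated sigma-algebras, so measurability is checked there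
       and not in the ambient one. *)
    rewrite -[X in sigma_process _ X]setTI.
    have mZ : measurable_fun setT
        (Z (i, j) : g_sigma_algebraType (process_generators M) -> R).
      apply: measurable_expRNM; apply: measurableT_comp => //.
      by apply: measurable_funB; exact: measurable_sigma_process.
    exact: mZ.
  rewrite kE !cellE// -(setTI (_ @^-1` _)) -[X in _ `&` X]setTI.
  have mS u : 0 <= u -> _ := @measurable_sigma_process _ _ _ G u.
  apply: (@measurableI _ (g_sigma_algebraType (process_generators G)));
    by apply: mS => //; exact: measurable_itv.
- by move=> w; exact: M_increment.
Qed.

(** Both sides of [integral_grid] converge by dominated convergence, all integrands being bounded by
    1. Monotonicity and stationarity of [G] then bring the limit to the single time [t - s]. *)
Lemma subordinated_laplace s t : 0 <= s -> s <= t ->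
  (\int[P]_w
     (expR (- (eta * `|subordinated M G t w - subordinated M G s w|)))%:E =
   \int[P]_w (expR (- (psi * G (t - s) w)))%:E)%E.
Proof.
move=> s0 st; have t0 : 0 <= t by exact: le_trans st.
have ts0 : 0 <= t - s by rewrite subr_ge0.
have expC (c : R) (x : R) : 0 <= c -> `|expR (- (c * `|x|))| <= 1.
  move=> c0; rewrite ger0_norm ?expR_ge0//.
  by have /andP[] := expRNM01 c0 (normr_ge0 x).
have mexp (c : R) (f g : T -> R) : measurable_fun setT f ->
    measurable_fun setT g ->
    measurable_fun setT (fun w => expR (- (c * `|f w - g w|))).
  move=> mf mg; apply: measurable_expRNM; apply: measurableT_comp => //.
  exact: measurable_funB.
have cexp (c a b : R) (f g : nat -> R) : f n @[n --> \oo] --> a ->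
    g n @[n --> \oo] --> b ->
    expR (- (c * `|f n - g n|)) @[n --> \oo] --> expR (- (c * `|a - b|)).
  move=> fa gb; apply: continuous_cvg; first exact: continuous_expR.
  apply: cvgN; apply: cvgM; first exact: cvg_cst.
  by apply: cvg_norm; exact: cvgB.
transitivity (\int[P]_w (expR (- (psi * `|G t w - G s w|)))%:E)%E; last first.
  transitivity (\int[P]_w (expR (- (psi * (G t w - G s w))))%:E)%E.
    by apply: eq_integral => w _; rewrite ger0_norm// subr_ge0 G_nd.
  have mf : measurable_fun setT (fun x : R => expR (- (psi * x))).
    exact: measurable_expRNM.
  have := levy_increment_integral hG mf (fun x => expR_ge0 _) s0 ts0.
  by rewrite subrKC.
have lhs := @cvg_integral_bounded _ _ _ P
  (fun N w => expR (- (eta * `|M (grid N (cell N t w)) w -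
      M (grid N (cell N s w)) w|))) _ 1
  (fun N => mexp eta _ _ (measurable_M_grid N t0) (measurable_M_grid N s0))
  (mexp eta _ _ (measurable_subordinated t0) (measurable_subordinated s0))
  (fun N w => expC eta _ eta0)
  (fun w => cexp eta _ _ _ _ (M_grid_cvg t0) (M_grid_cvg s0)).
have rhs := @cvg_integral_bounded _ _ _ P
  (fun N w => expR (- (psi * `|grid N (cell N t w) - grid N (cell N s w)|))) _ 1
  (fun N => mexp psi _ _ (measurable_grid N t0) (measurable_grid N s0))
  (mexp psi _ _ (mG t0) (mG s0))
  (fun N w => expC psi _ psi0)
  (fun w => cexp psi _ _ _ _ (grid_cvg t0) (grid_cvg s0)).
have := funext (fun N => integral_grid N s0 t0) => lr.
by rewrite lr in lhs; exact: cvg_unique lhs rhs.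
Qed.

End subordination.

(** * Long-range dependence *)

Section exponent.
Context {R : realType}.
Variables (alpha theta : R) (k : nat) (lambda : nat -> R).
Hypotheses (halpha : 0 < alpha <= 1) (htheta : 0 < theta) (hk : (1 <= k)%N).
Hypothesis hlambda : forall j, (1 <= j <= k)%N -> 0 < lambda j.

Let psi : R -> R := gcp_exponent k lambda.
Let dpsi (eta : R) : R :=
  \sum_(1 <= j < k.+1) lambda j * (j%:R * expR (- (eta * j%:R))).
(** Second derivatives, here and in [ddphi], are recorded at 0 only, as [cvg_second_difference]
    requires. *)
Let ddpsi : R := \sum_(1 <= j < k.+1) lambda j * (- j%:R ^+ 2).
Let dphi (x : R) : R :=
  alpha * (expR (- (x + theta)) * (x + theta) `^ (alpha - 1)).
Let ddphi : R :=
  alpha * (expR (- theta) * ((alpha - 1) * theta `^ (alpha - 1 - 1)) -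
    expR (- theta) * theta `^ (alpha - 1)).

Let a0 : 0 < alpha. Proof. by have /andP[] := halpha. Qed.

Let psi_ge0 eta : 0 <= eta -> 0 <= psi eta.
Proof. exact: gcp_exponent_ge0. Qed.

Let psi0 : psi 0 = 0.
Proof.
rewrite /psi /gcp_exponent big1// => j _.
by rewrite mul0r oppr0 expR0 subrr mulr0.
Qed.

(** The term [j = 1] is already positive. Strictness matters because the transform of the
    subordinator is given at positive arguments. *)
Lemma gcp_exponent_gt0 eta : 0 < eta -> 0 < psi eta.
Proof.
move=> e0; rewrite /psi /gcp_exponent big_ltn//.
have term j : (1 <= j <= k)%N -> 0 < lambda j * (1 - expR (- (eta * j%:R))).
  move=> /andP[j1 jk]; rewrite mulr_gt0 ?hlambda ?j1//.
  rewrite subr_gt0 -[X in _ < X]expR0 ltr_expR oppr_lt0 mulr_gt0// ltr0n//.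
rewrite ltr_wpDr//; last exact: term.
rewrite big_nat; apply: sumr_ge0 => j /andP[j2 jk].
by rewrite ltW// term// (ltnW j2).
Qed.

Let der_psi (eta : R) : is_derive eta 1 psi (dpsi eta).
Proof.
apply: is_derive_bigsum => j; apply: is_derive_eq.
by cbn; ring.
Qed.

Let der_dpsi : is_derive (0 : R) 1 dpsi ddpsi.
Proof.
apply: is_derive_bigsum => j; apply: is_derive_eq.
by rewrite mul0r oppr0 expR0; cbn; ring.
Qed.

Let der_phi (x : R) : 0 <= x -> is_derive x 1 (phi alpha theta) (dphi x).
Proof.
move=> x0; apply: is_derive_phi => //.
by rewrite (lt_le_trans _ x0)// oppr_lt0.
Qed.

Let der_dphi : is_derive (0 : R) 1 dphi ddphi.
Proof.
have ds : is_derive (0 : R) 1 (fun x => x + theta) 1.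
  by apply: is_derive_eq; rewrite addr0.
have t0 : 0 < 0 + theta by rewrite add0r.
have dp := is_derive1_comp (g := fun x => x + theta)
  (is_derive1_powR (alpha - 1) t0) ds.
rewrite /comp in dp.
apply: is_derive_eq.
by rewrite /ddphi add0r; cbn; ring.
Qed.

Let L (tau eta : R) : R := expR (- (tau * phi alpha theta (psi eta))).
Let dh (eta : R) : R := dphi (psi eta) * dpsi eta.

Let der_h (eta : R) : 0 <= eta ->
  is_derive eta 1 (phi alpha theta \o psi) (dh eta).
Proof.
move=> e0; apply: (is_derive1_comp (f := phi alpha theta) (g := psi)).
  exact: der_phi (psi_ge0 e0).
exact: der_psi.
Qed.

Let der_L (tau eta : R) : 0 <= eta ->
  is_derive eta 1 (L tau) (- (tau * dh eta) * L tau eta).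
Proof.
move=> e0; have := der_h e0; rewrite /comp => dh'.
by rewrite /L; apply: is_derive_eq; cbn; ring.
Qed.

Let L0 tau : L tau 0 = 1.
Proof. by rewrite /L psi0 /phi add0r subrr mulr0 oppr0 expR0. Qed.

Definition mean_rate : R := dh 0.
(** Minus the second derivative at 0 of [phi alpha theta \o psi], by the chain rule with
    [psi 0 = 0]: the second cumulant per unit time, as [mean_rate] is the first. *)
Definition variance_rate : R :=
  - (ddphi * dpsi 0 ^+ 2 + dphi 0 * ddpsi).

Lemma variance_rate_gt0 : 0 < variance_rate.
Proof.
have ddphi_le0 : 0 <= - ddphi.
  rewrite /ddphi -mulrN opprB mulr_ge0 ?(ltW a0)// subr_ge0.
  rewrite (@le_trans _ _ 0) ?mulr_ge0 ?expR_ge0 ?powR_ge0//.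
  rewrite mulr_ge0_le0 ?expR_ge0// mulr_le0_ge0 ?powR_ge0//.
  by rewrite subr_le0; have /andP[] := halpha.
have dphi_gt0 : 0 < dphi 0.
  by rewrite /dphi add0r !mulr_gt0 ?expR_gt0 ?powR_gt0.
have ddpsi_lt0 : 0 < - ddpsi.
  rewrite /ddpsi -sumrN big_ltn// ltr_wpDr//.
    rewrite big_nat; apply: sumr_ge0 => j /andP[j2 jk].
    by rewrite mulrN opprK mulr_ge0 ?sqr_ge0// ltW// hlambda// (ltnW j2).
  by rewrite mulrN opprK expr1n mulr1 hlambda.
rewrite (_ : variance_rate =
  - ddphi * dpsi 0 ^+ 2 + dphi 0 * - ddpsi).
  by apply: ltr_wpDl; [rewrite mulr_ge0 ?sqr_ge0|rewrite mulr_gt0].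
by rewrite /variance_rate; ring.
Qed.

Lemma laplace_diffquot_cvg1 tau :
  (1 - L tau eta) / eta @[eta --> 0^'+] --> tau * mean_rate.
Proof.
have := is_derive_cvg_at_right (der_L tau (lexx 0)).
rewrite L0 mulr1 => /cvgN; rewrite opprK.
apply: cvg_trans; apply: near_eq_cvg; apply: nearW => x.
transitivity (- ((L tau (0 + x) - 1) / x)); first by [].
by rewrite add0r -mulNr opprB.
Qed.

(** The limit is the second derivative of the transform at 0: variance plus squared mean over a time
    lag [tau]. *)
Lemma laplace_diffquot_cvg2 tau :
  (1 - 2 * L tau eta + L tau (2 * eta)) / eta ^+ 2 @[eta --> 0^'+] -->
  tau * variance_rate + (tau * mean_rate) ^+ 2.
Proof.
have d1 := der_L tau (lexx 0).
have d2 := der_dpsi.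
have d3 : is_derive (0 : R) 1 (fun x => dphi (psi x)) (ddphi * dpsi 0).
  apply: (is_derive1_comp (f := dphi) (g := psi)); last exact: der_psi.
  by rewrite psi0.
have d4 : is_derive (0 : R) 1 (fun eta => - (tau * dh eta) * L tau eta)
    (tau * variance_rate + (tau * mean_rate) ^+ 2).
  rewrite /dh; apply: is_derive_eq.
  by rewrite L0 /variance_rate /mean_rate /dh psi0; cbn; ring.
by have := cvg_second_difference (der_L tau) d4; rewrite L0.
Qed.

End exponent.

(** * Moments, covariance and correlation of the time-changed process *)

Theorem theorem5p1 (R : realType) (d : measure_display) (T : measurableType d)
  (P : probability T R) (alpha theta : R) (k : nat) (lambda : nat -> R)
  (M G : R -> T -> R)
  (halpha : 0 < alpha <= 1) (htheta : 0 < theta) (hk : (1 <= k)%N)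
  (hlambda : forall j, (1 <= j <= k)%N -> 0 < lambda j)
  (hM : generalized_counting_process P k lambda M)
  (hG : tempered_subordinator P alpha theta G)
  (hMG : independent_processes P M G) :
  LRD P (subordinated M G).
Proof.
have lM := gcp_levy hM; have lG := tsub_levy hG.
have G_nd := tsub_nondecreasing hG.
have G0 t w : 0 <= t -> 0 <= G t w by exact: subordinator_ge0 lG G_nd t w.
set X := subordinated M G.
have mX t : 0 <= t -> measurable_fun setT (X t).
  by move=> t0; exact: (measurable_subordinated lM lG G_nd t0).
have X_ge0 t w : 0 <= t -> 0 <= X t w.
  by move=> t0; apply: (gcp_ge0 hM); exact: G0.
have X0 w : X 0 w = 0.
  by rewrite /X /subordinated (levy_start lG) (levy_start lM).
pose m := mean_rate alpha theta k lambda.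
pose v := variance_rate alpha theta k lambda.
have v0 : 0 < v by exact: variance_rate_gt0.
have laplaceE s t : 0 <= s -> s <= t -> forall eta, 0 < eta ->
    (\int[P]_w (expR (- (eta * `|X t w - X s w|)))%:E =
     (expR (- ((t - s) * phi alpha theta (gcp_exponent k lambda eta))))%:E)%E.
  move=> s0 st eta eta0.
  have psi_gt0 : 0 < gcp_exponent k lambda eta by exact: gcp_exponent_gt0.
  rewrite (subordinated_laplace lM lG G_nd hMG (ltW eta0) (ltW psi_gt0))//.
    have ts0 : 0 <= t - s by rewrite subr_ge0.
    by have := tsub_laplace hG ts0 psi_gt0; rewrite unlock.
  move=> u u0; rewrite -(gcp_laplace hlambda hM (ltW eta0) u0).
  by apply: eq_integral => w _; rewrite ger0_norm// (gcp_ge0 hM).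
have mD s t : 0 <= s -> s <= t ->
    measurable_fun setT (fun w => `|X t w - X s w|).
  move=> s0 st; apply: measurableT_comp => //.
  by apply: measurable_funB; apply: mX => //; exact: le_trans st.
have D1 s t : 0 <= s -> s <= t ->
    (\int[P]_w (`|X t w - X s w|)%:E = ((t - s) * m)%:E)%E.
  move=> s0 st.
  apply: (integral_laplace1 (mD _ _ s0 st) _ (laplaceE _ _ s0 st)) => //.
  exact: laplace_diffquot_cvg1.
have D2 s t : 0 <= s -> s <= t ->
    (\int[P]_w ((X t w - X s w) ^+ 2)%:E =
     ((t - s) * v + ((t - s) * m) ^+ 2)%:E)%E.
  move=> s0 st.
  rewrite -(integral_laplace2 (mD _ _ s0 st) _ (laplaceE _ _ s0 st)
    (laplace_diffquot_cvg2 (tau := t - s) halpha htheta hlambda))//.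
  by apply: eq_integral => w _; rewrite real_normK ?num_real.
have X1 t : 0 <= t -> ('E_P[X t] = (t * m)%:E)%E.
  move=> t0; rewrite unlock -[t in RHS]subr0 -(D1 _ _ (lexx 0) t0).
  by apply: eq_integral => w _; rewrite X0 subr0 ger0_norm// X_ge0.
have DL2 s t : 0 <= s -> s <= t -> (X t \- X s) \in Lfun P 2%:E.
  move=> s0 st; apply: Lfun2_integral_sqr.
    by apply: measurable_funB; apply: mX => //; exact: le_trans st.
  by rewrite D2// ltry.
(* Values at a single time are increments from 0, so the results on increments cover them. *)
have XE t : X t = X t \- X 0.
  by apply/funext => w /=; rewrite X0 subr0.
have XL2 t : 0 <= t -> X t \in Lfun P 2%:E.
  by move=> t0; rewrite XE; exact: DL2.
have XL1 t : 0 <= t -> X t \in Lfun P 1.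
  by move=> t0; apply: Lfun_subset12 (XL2 _ t0); exact: fin_num_measure.
have VD s t : 0 <= s -> s <= t -> ('V_P[(X t \- X s)%R] = ((t - s) * v)%:E)%E.
  move=> s0 st; have t0 : 0 <= t by exact: le_trans st.
  rewrite varianceE ?DL2// expectationB ?XL1// !X1// {1}unlock.
  rewrite [X in (X - _)%E](D2 _ _ s0 st) -!EFinD.
  by congr EFin; ring.
have VX t : 0 <= t -> ('V_P[X t] = (t * v)%:E)%E.
  by move=> t0; rewrite XE VD// subr0.
have cov s t : 0 <= s -> s <= t -> (covariance P (X s) (X t) = (s * v)%:E)%E.
  move=> s0 st; have t0 : 0 <= t by exact: le_trans st.
  (* Finiteness of the covariance allows the polarisation identity [Var(X t - X s) = Var(X t) +
     Var(X s) - 2 Cov] to be solved in the reals. *)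
  have Cfin : covariance P (X s) (X t) \is a fin_num.
    by rewrite covariance_fin_num ?XL1// Lfun2_mul_Lfun1 ?XL2.
  have := varianceB (XL2 _ t0) (XL2 _ s0).
  rewrite VD// !VX// covarianceC -(fineK Cfin) => /(congr1 fine)/= E.
  by congr EFin; lra.
split.
- exact: mX.
- move=> t t0; split; first exact/XL2/ltW.
  by rewrite VX ?ltW// lte_fin mulr_gt0.
exists (2^-1); first by rewrite invr_gt0 ltr0n invf_lt1 ?ltr1n.
move=> s s0; exists (Num.sqrt s); first by rewrite sqrtr_gt0.
(* For [t >= s] the correlation equals [sqrt s * t^(-1/2)], so the ratio is exactly 1 from [s]
   on. *)
apply: cvg_near_cst.
near=> t.
have st : s <= t by near: t; apply: nbhs_pinfty_ge; exact: num_real.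
have t0 : 0 < t by exact: lt_le_trans st.
rewrite /correlation (cov _ _ (ltW s0) st) (VX _ (ltW s0)) (VX _ (ltW t0))/=.
rewrite powRN powR12_sqrt ?ltW// !sqrtrM ?ltW//.
have ss0 : Num.sqrt s != 0 by rewrite gt_eqF// sqrtr_gt0.
have tt0 : Num.sqrt t != 0 by rewrite gt_eqF// sqrtr_gt0.
have vv0 : Num.sqrt v != 0 by rewrite gt_eqF// sqrtr_gt0.
(* The numerator [s * v] is written with squares of roots, leaving a rational identity in the three
   roots. *)
rewrite -{1}(sqr_sqrtr (ltW s0)) -{1}(sqr_sqrtr (ltW v0)).
by field; rewrite ss0 tt0 vv0.
Unshelve. all: by end_near. Qed.
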